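(* Let $(\mathit{Sig},\mathit{Eq})$ be a signature of operations with equations, let $T = T_{(\mathit{Sig},\mathit{Eq})}$ be the monad it determines, let $W$ be an ordered monad, and let $\theta : T\to W$ be a monad morphism. Let $\mathrm{op} : I\leadsto O$ be an operation in $\mathit{Sig}$, with associated algebraic operation $\mathrm{op}^T$ on $T$. (1) The family $$\mathrm{op}^W_A\langle i,w\rangle \;=\; \mu^W_A\big(\theta_{WA}(\mathrm{op}^T_{WA}\langle i,\lambda o.\,\mathrm{ret}^T(w\,o)\rangle)\big),\qquad i:I,\; w : O\to WA,$$ is an algebraic operation $I\leadsto O$ for $W$. (2) Let $\mathcal D = \mathfrak{pre}\,\theta$ be the Dijkstra monad over $W$ given by $\mathcal D\,A\,w = \{m : TA\mid\theta_A(m)\le_A w\}$, with return and bind those of $T$. Then for all $i:I$, $w : O\to WA$ and $c : (o:O)\to\mathcal D\,A\,(w\,o)$ one has $\theta_A(\mathrm{op}^T_A\langle i,\lambda o.\,c\,o\rangle)\le_A\mathrm{op}^W_A\langle i,w\rangle$. Hence $\mathrm{op}^T$ induces $$\mathrm{op}^{\mathcal D}_A : (i:I)\to\big((o:O)\to\mathcal D\,A\,(w\,o)\big)\to\mathcal D\,A\,(\mathrm{op}^W_A\langle i,w\rangle),$$ and this satisfies $\mathrm{bind}^{\mathcal D}(\mathrm{op}^{\mathcal D}_A\langle i,c\rangle)\,f = \mathrm{op}^{\mathcal D}_B\langle i,\lambda o.\,\mathrm{bind}^{\mathcal D}(c\,o)\,f\rangle$ for all $f : (a:A)\to\mathcal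 D\,B\,(w'\,a)$ with $w' : A\to WB$.
   Context: A monad $M$ is a type constructor with $\mathrm{ret}^M : A\to MA$ and $\mathrm{bind}^M : MA\to(A\to MB)\to MB$ satisfying the usual laws; $\mu^M_A(w) = \mathrm{bind}^M w\,(\lambda w'.w')$ is its multiplication. A monad morphism is a family $\theta_A : MA\to WA$ preserving ret and bind. An ordered monad $W$ has a preorder $\le_A$ on each $WA$ such that bind is monotonic in both arguments (pointwise in the second). An algebraic operation $\mathrm{op} : I\leadsto O$ for a monad $M$ is a family $\mathrm{op}^M_A : I\times(O\to MA)\to MA$ such that for all $i:I$, $m : O\to MA$, $f : A\to MB$: $\mathrm{bind}^M(\mathrm{op}^M_A\langle i,m\rangle)\,f = \mathrm{op}^M_B\langle i,\lambda o.\,\mathrm{bind}^M(m\,o)\,f\rangle$. The monad $T_{(\mathit{Sig},\mathit{Eq})}$ is the free-model monad of the algebraic theory; it carries an algebraic operation $\mathrm{op}^T$ for each $\mathrm{op} : I\leadsto O$ in $\mathit{Sig}$. A Dijkstra monad over $W$ is a family of types $\mathcal D\,A\,w$ ($w : WA$) with $\mathrm{ret}^{\mathcal D} : (x:A)\to\mathcal D\,A\,(\mathrm{ret}^W x)$ and $\mathrm{bind}^{\mathcal D} : \mathcal D\,A\,w_1\to((x:A)\to\mathcal D\,B\,(w_2\,x))\to\mathcal D\,B\,(\mathrm{bind}^W w_1\,w_2)$ satisfying the three monad-style laws. *)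

(* Defs.v *)
From HB Require Import structures.
From mathcomp Require Import all_boot boolp.
From mathcomp Require Import generic_quotient.
Import EqNotations.

Set Implicit Arguments.
Unset Strict Implicit.
Unset Printing Implicit Defensive.

Local Open Scope quotient_scope.

Record monad := Monad {
  monad_fun :> Type -> Type;
  ret : forall A, A -> monad_fun A;
  bind : forall A B, monad_fun A -> (A -> monad_fun B) -> monad_fun B;
  bind_ret_l : forall A B (a : A) (f : A -> monad_fun B), bind (ret a) f = f a;
  bind_ret_r : forall A (m : monad_fun A), bind m (fun a => ret a) = m;
  bind_assoc : forall A B C (m : monad_fun A)
    (f : A -> monad_fun B) (g : B -> monad_fun C),
    bind (bind m f) g = bind m (fun a => bind (f a) g) }.

Arguments ret M {A} a : rename.
Arguments bind M {A B} m f : rename.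
Arguments bind_ret_l M {A B} a f : rename.
Arguments bind_ret_r M {A} m : rename.
Arguments bind_assoc M {A B C} m f g : rename.

Definition mu (M : monad) (A : Type) (m : M (M A)) : M A := bind M m (fun x => x).

Record monad_morphism (M W : monad) := MonadMorphism {
  morphism_fun :> forall A, M A -> W A;
  morphism_ret : forall A (a : A), morphism_fun (ret M a) = ret W a;
  morphism_bind : forall A B (m : M A) (f : A -> M B),
    morphism_fun (bind M m f) =
    bind W (morphism_fun m) (fun a => morphism_fun (f a)) }.

Record ordered_monad := OrderedMonad {
  ordered_monad_monad :> monad;
  mle : forall A, ordered_monad_monad A -> ordered_monad_monad A -> Prop;
  mle_refl : forall A (w : ordered_monad_monad A), mle w w;
  mle_trans : forall A (w1 w2 w3 : ordered_monad_monad A),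
    mle w1 w2 -> mle w2 w3 -> mle w1 w3;
  mle_bind : forall A B (w w' : ordered_monad_monad A)
    (f f' : A -> ordered_monad_monad B),
    mle w w' -> (forall a, mle (f a) (f' a)) ->
    mle (bind ordered_monad_monad w f) (bind ordered_monad_monad w' f') }.

Arguments mle W {A} w1 w2 : rename.

Definition algebraic_operation (M : monad) (I O : Type)
    (op : forall A, I -> (O -> M A) -> M A) : Prop :=
  forall A B (i : I) (m : O -> M A) (f : A -> M B),
    bind M (op A i m) f = op B i (fun o => bind M (m o) f).

Arguments algebraic_operation M I O op : clear implicits.

Record signature := Signature {
  sig_op :> Type;
  inp : sig_op -> Type;
  out : sig_op -> Type }.

Inductive term (Sig : signature) (A : Type) : Type :=
| Var of A
| Op (op : Sig) of inp op & (out op -> term Sig A).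

Arguments Var {Sig A} a : rename.
Arguments Op {Sig A op} i k : rename.

(* Each equation comes with its own type of variables.  An axiom scheme, such
   as "put s; get k = put s; k s", is a family of such equations. *)
Record equations (Sig : signature) := Equations {
  eq_index : Type;
  eq_var : eq_index -> Type;
  eq_lhs : forall e, term Sig (eq_var e);
  eq_rhs : forall e, term Sig (eq_var e) }.

Definition algebra (Sig : signature) (X : Type) :=
  forall op : Sig, inp op -> (out op -> X) -> X.

Fixpoint eval (Sig : signature) (A X : Type) (alg : algebra Sig X) (f : A -> X)
    (t : term Sig A) : X :=
  match t with
  | Var a => f a
  | Op op i k => alg op i (fun o => eval alg f (k o))
  end.

Definition is_model (Sig : signature) (Eq : equations Sig) (X : Type)
    (alg : algebra Sig X) : Prop :=
  forall (e : eq_index Eq) (s : eq_var e -> X),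
    eval alg s (eq_lhs e) = eval alg s (eq_rhs e).

Definition subst (Sig : signature) (A B : Type) (s : A -> term Sig B) :
    term Sig A -> term Sig B :=
  eval (fun op i k => Op i k) s.

Section FreeModel.
Variables (Sig : signature) (Eq : equations Sig).

Inductive provable (A : Type) : term Sig A -> term Sig A -> Prop :=
| provable_refl t : provable t t
| provable_sym t u : provable t u -> provable u t
| provable_trans t u v : provable t u -> provable u v -> provable t v
| provable_op (op : Sig) (i : inp op) (k k' : out op -> term Sig A) :
    (forall o, provable (k o) (k' o)) -> provable (Op i k) (Op i k')
| provable_eq (e : eq_index Eq) (s : eq_var e -> term Sig A) :
    provable (subst s (eq_lhs e)) (subst s (eq_rhs e)).

HB.instance Definition _ (A : Type) := gen_eqMixin (term Sig A).
HB.instance Definition _ (A : Type) := gen_choiceMixin (term Sig A).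

Definition provableb (A : Type) : rel (term Sig A) :=
  fun t u => `[< provable t u >].

Lemma provableb_refl A : reflexive (@provableb A).
Proof. by move=> t; apply/asboolP; exact: provable_refl. Qed.

Lemma provableb_sym A : symmetric (@provableb A).
Proof. by move=> t u; apply/asboolP/asboolP; exact: provable_sym. Qed.

Lemma provableb_trans A : transitive (@provableb A).
Proof.
move=> u t v /asboolP tu /asboolP uv; apply/asboolP.
exact: provable_trans tu uv.
Qed.

Canonical provable_equiv A :=
  EquivRel (@provableb A) (@provableb_refl A) (@provableb_sym A)
    (@provableb_trans A).

Definition free_model (A : Type) : Type := {eq_quot (provable_equiv A)}.

Definition cls (A : Type) (t : term Sig A) : free_model A :=
  \pi_{eq_quot (provable_equiv A)} t.

Definition rep (A : Type) (m : free_model A) : term Sig A :=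
  @repr (term Sig A) {eq_quot (provable_equiv A)} m.

Definition free_ret (A : Type) (a : A) : free_model A := cls (Var a).

Definition free_op (A : Type) : algebra Sig (free_model A) :=
  fun op i m => cls (Op i (fun o => rep (m o))).

(* The value does not depend on the representative as soon as [alg] is a
   model, see [free_extend_ret], [free_extend_op] and [free_extend_uniq]. *)
Definition free_extend (A X : Type) (alg : algebra Sig X) (f : A -> X)
    (m : free_model A) : X := eval alg f (rep m).

Definition free_bind (A B : Type) (m : free_model A) (f : A -> free_model B) :
    free_model B := free_extend (@free_op B) f m.

Lemma repK A (m : free_model A) : cls (rep m) = m.
Proof. exact: reprK. Qed.

Lemma clsP A (t u : term Sig A) : provable t u <-> cls t = cls u.
Proof.
split=> [tu|]; first by apply/eqmodP; apply/asboolP.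
by move/eqmodP/asboolP.
Qed.

Lemma rep_cls A (t : term Sig A) : provable (rep (cls t)) t.
Proof. by apply/clsP; rewrite repK. Qed.

Lemma free_op_cls A (op : Sig) (i : inp op) (k : out op -> term Sig A) :
  free_op i (fun o => cls (k o)) = cls (Op i k).
Proof. by apply/clsP; apply: provable_op => o; exact: rep_cls. Qed.

Lemma eval_free_op A B (s : A -> free_model B) (t : term Sig A) :
  eval (@free_op B) s t = cls (subst (fun a => rep (s a)) t).
Proof.
elim: t => [a|op i k IH] /=; first by rewrite repK.
rewrite -free_op_cls; congr free_op.
by apply: funext => o; exact: IH.
Qed.

Lemma eval_subst A B X (alg : algebra Sig X) (s : A -> term Sig B)
    (f : B -> X) (t : term Sig A) :
  eval alg f (subst s t) = eval alg (fun a => eval alg f (s a)) t.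
Proof.
elim: t => [//|op i k IH] /=.
by congr (alg _ _); apply: funext => o; exact: IH.
Qed.

Lemma eval_provable A X (alg : algebra Sig X) (f : A -> X) (t u : term Sig A) :
  is_model Eq alg -> provable t u -> eval alg f t = eval alg f u.
Proof.
move=> algE; elim=> {t u} [//|t u _ -> //|t u v _ -> _ -> //| |e s].
  move=> op i k k' _ IH /=.
  by congr (alg _ _); apply: funext => o; exact: IH.
by rewrite !eval_subst; exact: algE.
Qed.

Lemma free_model_is_model A : is_model Eq (@free_op A).
Proof. by move=> e s; rewrite !eval_free_op; apply/clsP; exact: provable_eq. Qed.

Lemma free_extend_cls A X (alg : algebra Sig X) (f : A -> X) t :
  is_model Eq alg -> free_extend alg f (cls t) = eval alg f t.
Proof. by move=> algE; apply: eval_provable => //; exact: rep_cls. Qed.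

Lemma free_extend_ret A X (alg : algebra Sig X) (f : A -> X) a :
  is_model Eq alg -> free_extend alg f (free_ret a) = f a.
Proof. by move=> algE; rewrite free_extend_cls. Qed.

Lemma free_extend_op A X (alg : algebra Sig X) (f : A -> X) (op : Sig)
    (i : inp op) (m : out op -> free_model A) :
  is_model Eq alg ->
  free_extend alg f (free_op i m) = alg op i (fun o => free_extend alg f (m o)).
Proof. by move=> algE; rewrite free_extend_cls. Qed.

Lemma free_extend_uniq A X (alg : algebra Sig X) (f : A -> X)
    (h : free_model A -> X) :
  (forall a, h (free_ret a) = f a) ->
  (forall (op : Sig) (i : inp op) m,
     h (free_op i m) = alg op i (fun o => h (m o))) ->
  forall m, h m = free_extend alg f m.
Proof.
move=> hret hop m; rewrite -{1}(repK m) /free_extend.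
elim: (rep m) => [a|op i k IH] /=; first exact: hret.
rewrite -free_op_cls hop.
by congr (alg _ _); apply: funext => o; exact: IH.
Qed.

Lemma free_bind_ret_l A B (a : A) (f : A -> free_model B) :
  free_bind (free_ret a) f = f a.
Proof. by apply: free_extend_ret; exact: free_model_is_model. Qed.

Lemma free_bind_op A B (op : Sig) (i : inp op) (m : out op -> free_model A)
    (f : A -> free_model B) :
  free_bind (free_op i m) f = free_op i (fun o => free_bind (m o) f).
Proof. by apply: free_extend_op; exact: free_model_is_model. Qed.

Lemma free_bind_ret_r A (m : free_model A) :
  free_bind m (fun a => free_ret a) = m.
Proof. by rewrite /free_bind -(@free_extend_uniq _ _ _ _ id). Qed.

Lemma free_bind_assoc A B C (m : free_model A) (f : A -> free_model B)
    (g : B -> free_model C) :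
  free_bind (free_bind m f) g = free_bind m (fun a => free_bind (f a) g).
Proof.
apply: (@free_extend_uniq _ _ _ _ (fun m => free_bind (free_bind m f) g)).
  by move=> a; rewrite free_bind_ret_l.
by move=> op i k; rewrite !free_bind_op.
Qed.

Definition free_model_monad : monad :=
  Monad free_bind_ret_l free_bind_ret_r free_bind_assoc.

Definition opT (op : Sig) (A : Type) (i : inp op)
    (m : out op -> free_model_monad A) : free_model_monad A := free_op i m.

Lemma opT_algebraic (op : Sig) :
  algebraic_operation free_model_monad (inp op) (out op) (@opT op).
Proof. by move=> A B i m f; exact: free_bind_op. Qed.

Definition opW (W : monad) (theta : monad_morphism free_model_monad W)
    (op : Sig) (A : Type) (i : inp op) (w : out op -> W A) : W A :=
  mu (theta (W A) (opT i (fun o => ret free_model_monad (w o)))).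

End FreeModel.

Arguments opT {Sig Eq} op A i m.
Arguments opW {Sig Eq W} theta op A i w.

(* The two sides of each law live over specifications which are equal only by
   the corresponding law of [W], hence the transports. *)
Record dijkstra_monad (W : monad) := DijkstraMonad {
  dm_fun :> forall A, W A -> Type;
  dret : forall A (a : A), dm_fun (ret W a);
  dbind : forall A B (w1 : W A) (w2 : A -> W B),
    dm_fun w1 -> (forall a, dm_fun (w2 a)) -> dm_fun (bind W w1 w2);
  dbind_ret_l : forall A B (a : A) (w2 : A -> W B) (f : forall x, dm_fun (w2 x)),
    rew [@dm_fun B] bind_ret_l W a w2 in dbind (dret a) f = f a;
  dbind_ret_r : forall A (w : W A) (c : dm_fun w),
    rew [@dm_fun A] bind_ret_r W w in dbind c (fun a => dret a) = c;
  dbind_assoc : forall A B C (w1 : W A) (w2 : A -> W B) (w3 : B -> W C)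
    (c : dm_fun w1) (f : forall a, dm_fun (w2 a)) (g : forall b, dm_fun (w3 b)),
    rew [@dm_fun C] bind_assoc W w1 w2 w3 in dbind (dbind c f) g =
    dbind c (fun a => dbind (f a) g) }.

Arguments dm_fun {W} D A w : rename.
Arguments dret {W} D {A} a : rename.
Arguments dbind {W} D {A B w1 w2} c f : rename.

Section Pre.
Variables (M : monad) (W : ordered_monad) (theta : monad_morphism M W).

Definition pre_fun (A : Type) (w : W A) : Type := {m : M A | mle W (theta A m) w}.

Lemma pre_ret_subproof A (a : A) : mle W (theta A (ret M a)) (ret W a).
Proof. by rewrite morphism_ret; exact: mle_refl. Qed.

Definition pre_ret (A : Type) (a : A) : pre_fun (ret W a) :=
  exist _ (ret M a) (pre_ret_subproof a).

Lemma pre_bind_subproof A B (w1 : W A) (w2 : A -> W B) (c : pre_fun w1)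
    (f : forall a, pre_fun (w2 a)) :
  mle W (theta B (bind M (sval c) (fun a => sval (f a)))) (bind W w1 w2).
Proof.
rewrite morphism_bind; apply: mle_bind => [|a]; first exact: (svalP c).
exact: (svalP (f a)).
Qed.

Definition pre_bind (A B : Type) (w1 : W A) (w2 : A -> W B) (c : pre_fun w1)
    (f : forall a, pre_fun (w2 a)) : pre_fun (bind W w1 w2) :=
  exist _ (bind M (sval c) (fun a => sval (f a))) (pre_bind_subproof c f).

Lemma pre_eq A (w w' : W A) (e : w = w') (c : pre_fun w) (c' : pre_fun w') :
  sval c = sval c' -> rew [@pre_fun A] e in c = c'.
Proof.
case: w' / e c' => -[m' h'] /=; case: c => m h /= mm'.
by subst m'; congr exist; exact: Prop_irrelevance.
Qed.

Lemma pre_bind_ret_l A B (a : A) (w2 : A -> W B) (f : forall x, pre_fun (w2 x)) :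
  rew [@pre_fun B] bind_ret_l W a w2 in pre_bind (pre_ret a) f = f a.
Proof. by apply: pre_eq; rewrite /= bind_ret_l. Qed.

Lemma pre_bind_ret_r A (w : W A) (c : pre_fun w) :
  rew [@pre_fun A] bind_ret_r W w in pre_bind c (fun a => pre_ret a) = c.
Proof. by apply: pre_eq; rewrite /= bind_ret_r. Qed.

Lemma pre_bind_assoc A B C (w1 : W A) (w2 : A -> W B) (w3 : B -> W C)
    (c : pre_fun w1) (f : forall a, pre_fun (w2 a)) (g : forall b, pre_fun (w3 b)) :
  rew [@pre_fun C] bind_assoc W w1 w2 w3 in pre_bind (pre_bind c f) g =
  pre_bind c (fun a => pre_bind (f a) g).
Proof. by apply: pre_eq; rewrite /= bind_assoc. Qed.

Definition pre : dijkstra_monad W :=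
  DijkstraMonad pre_bind_ret_l pre_bind_ret_r pre_bind_assoc.

End Pre.

Section InducedOperation.
Variables (Sig : signature) (Eq : equations Sig) (W : ordered_monad).
Variables (theta : monad_morphism (free_model_monad Eq) W) (op : Sig).

Definition opT_below_opW : Prop :=
  forall A (i : inp op) (w : out op -> W A) (c : forall o, pre theta A (w o)),
    mle W (theta A (opT op A i (fun o => sval (c o)))) (opW theta op A i w).

Definition opD (le_op : opT_below_opW) (A : Type) (i : inp op)
    (w : out op -> W A) (c : forall o, pre theta A (w o)) :
    pre theta A (opW theta op A i w) :=
  exist _ (opT op A i (fun o => sval (c o))) (le_op A i w c).

End InducedOperation.

Arguments opT_below_opW {Sig Eq W} theta op.
Arguments opD {Sig Eq W theta op} le_op {A} i {w} c.

(* Main.v *)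
Require Import Defs.
From mathcomp Require Import all_boot.
From mathcomp Require Import boolp.
Import EqNotations.

(** An algebraic operation is determined by its generic effect
    [g i = op i ret], namely [op i m = bind (g i) m]; conversely every family
    [g i : M O] yields an algebraic operation in this way, by associativity.
    The operation [opW] turns out to be the one with generic effect
    [theta (g i)], from which both parts follow. *)

Definition generic_effect {M : monad} {I O : Type}
    (op : forall A, I -> (O -> M A) -> M A) (i : I) : M O :=
  op O i (fun o => ret M o).

Lemma algebraic_operationE (M : monad) (I O : Type)
    (op : forall A, I -> (O -> M A) -> M A) :
  algebraic_operation M I O op ->
  forall A i (m : O -> M A), op A i m = bind M (generic_effect op i) m.
Proof.
move=> opA A i m; rewrite opA; congr (op A i _).
by apply: funext => o; rewrite bind_ret_l.
Qed.

Lemma bind_algebraic (M : monad) (I O : Type) (g : I -> M O) :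
  algebraic_operation M I O (fun A i m => bind M (g i) m).
Proof. by move=> A B i m f; rewrite bind_assoc. Qed.

(** Writing [op] as a bind after its generic effect lets [theta] pass through by [morphism_bind]. *)
Lemma morphism_algebraic_operation (M W : monad) (theta : monad_morphism M W)
    (I O : Type) (op : forall A, I -> (O -> M A) -> M A) :
  algebraic_operation M I O op ->
  forall A i (m : O -> M A),
    theta A (op A i m) =
    bind W (theta O (generic_effect op i)) (fun o => theta A (m o)).
Proof.
by move=> opA A i m; rewrite (@algebraic_operationE _ _ _ _ opA) morphism_bind.
Qed.

(** Since [theta] sends each [ret (w o)] to [ret W (w o)], the multiplication [mu] collapses by
    associativity and the left unit law. *)
Lemma opWE (Sig : signature) (Eq : equations Sig) (W : monad)
    (theta : monad_morphism (free_model_monad Eq) W) (op : Sig) A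
    (i : inp op) (w : out op -> W A) :
  opW theta op A i w =
  bind W (theta (out op) (generic_effect (opT op) i)) w.
Proof.
rewrite /opW (@morphism_algebraic_operation _ _ _ _ _ _ (@opT_algebraic _ _ op)).
rewrite /mu bind_assoc; congr (bind W _ _).
by apply: funext => o; rewrite morphism_ret bind_ret_l.
Qed.

Lemma opW_algebraic (Sig : signature) (Eq : equations Sig) (W : monad)
    (theta : monad_morphism (free_model_monad Eq) W) (op : Sig) :
  algebraic_operation W (inp op) (out op) (opW theta op).
Proof. by move=> A B i w f; rewrite !opWE; exact: bind_algebraic. Qed.

(** Both sides are binds after the same [theta (g i)], so monotonicity in the continuation
    suffices. *)
Lemma opT_le_opW (Sig : signature) (Eq : equations Sig) (W : ordered_monad)
    (theta : monad_morphism (free_model_monad Eq) W) (op : Sig) :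
  opT_below_opW theta op.
Proof.
move=> A i w c; rewrite opWE.
rewrite (@morphism_algebraic_operation _ _ _ _ _ _ (@opT_algebraic _ _ op)).
by apply: mle_bind => [|o]; [exact: mle_refl | exact: (svalP (c o))].
Qed.

(* The two sides of the last equation live over specifications that are equal
   by part (1), hence the transport along [alg_op]. *)
Theorem mainTheorem5 (Sig : signature) (Eq : equations Sig) (W : ordered_monad)
    (theta : monad_morphism (free_model_monad Eq) W) (op : Sig) :
  exists alg_op : algebraic_operation W (inp op) (out op) (opW theta op),
  exists le_op :
    (forall (A : Type) (i : inp op) (w : out op -> W A)
        (c : forall o, pre theta A (w o)),
      mle W (theta A (opT op A i (fun o => sval (c o)))) (opW theta op A i w)),
  forall (A B : Type) (i : inp op) (w : out op -> W A)
      (c : forall o, pre theta A (w o))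
      (w' : A -> W B) (f : forall a, pre theta B (w' a)),
    rew [pre theta B] alg_op A B i w w' in dbind (pre theta) (opD le_op i c) f =
    opD le_op i (fun o => dbind (pre theta) (c o) f).
Proof.
exists (@opW_algebraic _ _ _ theta op), (@opT_le_opW _ _ _ theta op).
(* By proof irrelevance, [pre_eq] removes the transport and leaves an equation between computations
   in the free-model monad. *)
by move=> A B i w c w' f; apply: pre_eq; exact: opT_algebraic.
Qed.
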